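(* Let $\Bbbk$ be an algebraically closed field of arbitrary characteristic, let $d$ be a positive integer, and let $S=\Bbbk[x_1,x_2,x_3]$ with the standard grading ($\deg x_1=\deg x_2=\deg x_3=1$). Let $z\in \mathrm{Hilb}^d(\mathbb{A}^3)$ be a point parametrizing a homogeneous ideal $I\subseteq S$ (so $\dim_{\Bbbk}(S/I)=d$), and let $T_z$ be the tangent space to $\mathrm{Hilb}^d(\mathbb{A}^3)$ at $z$. Then $$\dim_{\Bbbk} T_z\equiv d \pmod 2.$$
   Context: $\mathrm{Hilb}^d(\mathbb{A}^3)$ is the Hilbert scheme of $d$ points in $\mathbb{A}^3=\mathbb{A}^3_{\Bbbk}$, parametrizing closed zero-dimensional subschemes of $\mathbb{A}^3$ of degree $d$; its closed points correspond to ideals $I\subseteq S=\Bbbk[x_1,x_2,x_3]$ with $\dim_{\Bbbk}(S/I)=d$. The tangent space at the closed point $z$ corresponding to $I$ is $T_z=\mathrm{Hom}_S(I,S/I)$ (all $S$-module homomorphisms, not only the degree-preserving ones). *)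

(* Defs.v *)
From HB Require Import structures.
From mathcomp Require Import all_boot all_order all_algebra.
From mathcomp Require Import boolp mpoly.

Set Implicit Arguments.
Unset Strict Implicit.
Unset Printing Implicit Defensive.

Import GRing.Theory.
Local Open Scope ring_scope.
Local Open Scope quotient_scope.

(* Ideals are terms of type [idealr R]: proper ideals, given as boolean
   predicates. Classically every ideal has such a predicate, and an ideal is
   proper exactly when its quotient is nonzero. *)

Section IdealModule.
Variables (R : comNzRingType) (I : idealr R).

Record ideal_mod := IdealMod { ideal_val : R; _ : ideal_val \in (I : pred R) }.
HB.instance Definition _ := [isSub for ideal_val].
HB.instance Definition _ := [Choice of ideal_mod by <:].
HB.instance Definition _ := [SubChoice_isSubZmodule of ideal_mod by <:].

Definition ideal_scale (a : R) (u : ideal_mod) : ideal_mod :=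
  IdealMod (idealMr a (valP u)).

Fact ideal_scaleA a b u :
  ideal_scale a (ideal_scale b u) = ideal_scale (a * b) u.
Proof. by apply: val_inj; rewrite /= mulrA. Qed.
Fact ideal_scale1 : left_id 1 ideal_scale.
Proof. by move=> u; apply: val_inj; rewrite /= mul1r. Qed.
Fact ideal_scaleDr : right_distributive ideal_scale +%R.
Proof. by move=> a u v; apply: val_inj; rewrite /= mulrDr. Qed.
Fact ideal_scaleDl u : {morph ideal_scale^~ u : a b / a + b}.
Proof. by move=> a b; apply: val_inj; rewrite /= mulrDl. Qed.

HB.instance Definition _ := GRing.Zmodule_isLmodule.Build R ideal_mod
  ideal_scaleA ideal_scale1 ideal_scaleDr ideal_scaleDl.

End IdealModule.

Section QuotientModule.
Variables (R : comNzRingType) (I : idealr R).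

Definition quot_mod := {ideal_quot I}.
HB.instance Definition _ := GRing.Zmodule.on quot_mod.

Definition quot_scale (a : R) (x : quot_mod) : quot_mod :=
  (\pi_{ideal_quot I} a : {ideal_quot I}) * (x : {ideal_quot I}).

Fact quot_scaleA a b x : quot_scale a (quot_scale b x) = quot_scale (a * b) x.
Proof. by rewrite /quot_scale rmorphM mulrA. Qed.
Fact quot_scale1 : left_id 1 quot_scale.
Proof. by move=> x; rewrite /quot_scale rmorph1 mul1r. Qed.
Fact quot_scaleDr : right_distributive quot_scale +%R.
Proof. by move=> a x y; rewrite /quot_scale mulrDr. Qed.
Fact quot_scaleDl x : {morph quot_scale^~ x : a b / a + b}.
Proof. by move=> a b; rewrite /quot_scale rmorphD mulrDl. Qed.

HB.instance Definition _ := GRing.Zmodule_isLmodule.Build R quot_mod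
  quot_scaleA quot_scale1 quot_scaleDr quot_scaleDl.

End QuotientModule.

Section HomModule.
Variables (R : comNzRingType) (U V : lmodType R).

Definition hom_mod := {linear U -> V}.
HB.instance Definition _ := gen_eqMixin hom_mod.
HB.instance Definition _ := gen_choiceMixin hom_mod.

Fact hom_modP (f g : hom_mod) : (forall u, f u = g u) -> f = g.
Proof.
case: f g => [f cf] [g cg] fg; have {fg} E : f = g by apply: funext.
case: _ / E cg => -[[a1] [z1]]; case: cf => [[a0] [z0]].
by rewrite (Prop_irrelevance a0 a1) (Prop_irrelevance z0 z1).
Qed.

Definition hom_zero : hom_mod := (\0 : U -> V).
Definition hom_add (f g : hom_mod) : hom_mod := f \+ g.
Definition hom_opp (f : hom_mod) : hom_mod := \- f.
Definition hom_scale (a : R) (f : hom_mod) : hom_mod := a \*: f.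

Fact hom_addA : associative hom_add.
Proof. by move=> f g h; apply: hom_modP => u; rewrite /= addrA. Qed.
Fact hom_addC : commutative hom_add.
Proof. by move=> f g; apply: hom_modP => u; rewrite /= addrC. Qed.
Fact hom_add0 : left_id hom_zero hom_add.
Proof. by move=> f; apply: hom_modP => u; rewrite /= add0r. Qed.
Fact hom_addN : left_inverse hom_zero hom_opp hom_add.
Proof. by move=> f; apply: hom_modP => u; rewrite /= addNr. Qed.
HB.instance Definition _ := GRing.isZmodule.Build hom_mod
  hom_addA hom_addC hom_add0 hom_addN.

Fact hom_scaleA a b f : hom_scale a (hom_scale b f) = hom_scale (a * b) f.
Proof. by apply: hom_modP => u; rewrite /= scalerA. Qed.
Fact hom_scale1 : left_id 1 hom_scale.
Proof. by move=> f; apply: hom_modP => u; rewrite /= scale1r. Qed.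
Fact hom_scaleDr : right_distributive hom_scale +%R.
Proof. by move=> a f g; apply: hom_modP => u; rewrite /= scalerDr. Qed.
Fact hom_scaleDl f : {morph hom_scale^~ f : a b / a + b}.
Proof. by move=> a b; apply: hom_modP => u; rewrite /= scalerDl. Qed.
HB.instance Definition _ := GRing.Zmodule_isLmodule.Build R hom_mod
  hom_scaleA hom_scale1 hom_scaleDr hom_scaleDl.

End HomModule.

Section Restriction.
Variables (n : nat) (k : comNzRingType) (V : lmodType {mpoly k[n]}).

(* [V] with scalars restricted along the inclusion of the constants. *)
Definition restr_mod : Type := V.
HB.instance Definition _ := GRing.Zmodule.on restr_mod.

Definition restr_scale (c : k) (v : restr_mod) : restr_mod :=
  (c%:MP_[n] : {mpoly k[n]}) *: (v : V).

Fact restr_scaleA a b v : restr_scale a (restr_scale b v) = restr_scale (a * b) v.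
Proof. by rewrite /restr_scale scalerA mpolyCM. Qed.
Fact restr_scale1 : left_id 1 restr_scale.
Proof. by move=> v; rewrite /restr_scale mpolyC1 scale1r. Qed.
Fact restr_scaleDr : right_distributive restr_scale +%R.
Proof. by move=> a u v; rewrite /restr_scale scalerDr. Qed.
Fact restr_scaleDl v : {morph restr_scale^~ v : a b / a + b}.
Proof. by move=> a b; rewrite /restr_scale mpolyCD scalerDl. Qed.
HB.instance Definition _ := GRing.Zmodule_isLmodule.Build k restr_mod
  restr_scaleA restr_scale1 restr_scaleDr restr_scaleDl.

End Restriction.

(* [V] is a vector space of finite dimension [m]: it has a linear bijection
   to [k^m]. *)
Definition has_dim (k : fieldType) (V : lmodType k) (m : nat) : Prop :=
  inhabited (Vector.axiom m V).

Definition homogeneous_ideal n (k : comNzRingType) (I : idealr {mpoly k[n]}) :=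
  forall (e : nat) (p : {mpoly k[n]}),
    p \in (I : pred _) -> pihomog (@mdeg n) e p \in (I : pred _).

(* The tangent space to the Hilbert scheme of points at the point given by [I]:
   all of Hom_S(I, S/I), with no condition on degrees. *)
Definition hilb_tangent n (k : fieldType) (I : idealr {mpoly k[n]}) : lmodType k :=
  restr_mod (hom_mod (ideal_mod I) (quot_mod I)).

(* Main.v *)
Require Import Defs.
From HB Require Import structures.
From mathcomp Require Import all_boot all_order all_algebra.
From mathcomp Require Import boolp mpoly.
Set Implicit Arguments.
Unset Strict Implicit.
Unset Printing Implicit Defensive.
Import GRing.Theory.
Local Open Scope ring_scope.
Local Open Scope quotient_scope.

(** Write S for the polynomial ring, M = S/I and d = dim M. Since I kills M,
the exact sequence 0 -> I -> S -> M -> 0 identifies the tangent space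
Hom_S(I, M) with Ext^1_S(M, M). In coordinates on M, let X_i be the matrix of
multiplication by the i-th variable. A k-linear derivation from S to End_k(M)
is determined by the images u_i of the variables, subject to
[X_i, u_j] = [X_j, u_i], and Ext^1 is the space of these cocycles u modulo the
coboundaries u_i = [A, X_i].

The matrices commuting with all X_i are the S-endomorphisms of the cyclic
module M, that is, M itself; so the coboundaries have dimension d^2 - d
([dim_limg_coboundary]). With three variables there are 3 d^2 coordinates
in u = (u_1, u_2, u_3), and the cocycles are the kernel of the curl
u |-> X x u, the cross product formed with commutators
([curl_kerP]). Hence
dim T = 3 d^2 - rank(curl) - (d^2 - d), which has the parity of d as soon as
the curl has even rank.

The curl is self-adjoint for the trace form ([curl_selfadjoint]). Because I is
homogeneous, End_k(M) is graded; the curl raises degrees by one while the trace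
form pairs degree j with degree -j, so the symmetric form <curl u, v> pairs
degree j with degree -1 - j. These are never equal: the form vanishes on the
part of degree >= 0 and on the part of degree < 0, so its Gram matrix is block
antidiagonal with two mutually transposed blocks, and its rank is even in every
characteristic ([even_rank_selfadjoint], [even_rank_curl]). *)

(** * Self-adjoint operators with two complementary isotropic parts *)

Section Form.
Variables (K : fieldType) (W : vectType K) (b : W -> W -> K).
Hypothesis form_linear : forall a u u' v,
  b (a *: u + u') v = a * b u v + b u' v.
Hypothesis form_sym : forall u v, b u v = b v u.
Hypothesis form_nondeg : forall u, (forall v, b u v = 0) -> u = 0.

(** The kernel of [h] is the orthogonal complement of the image of [g], which is
cut out by as many equations as that image has dimension. *)
Lemma dim_limg_adjoint_le (g h : 'End(W)) :
  (forall u v, b (g u) v = b u (h v)) ->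
  (\dim (limg h) <= \dim (limg g))%N.
Proof.
move=> adj; set m := \dim (limg g).
pose e := vbasis (limg g).
pose c (v : W) : 'rV[K]_m := \row_i b v (tnth e i).
have c_lin : linear c by move=> a u v; apply/rowP=> i; rewrite !mxE form_linear.
pose cM := GRing.isLinear.Build K W 'rV[K]_m _ c c_lin.
pose cL : {linear W -> 'rV[K]_m} := HB.pack c cM.
have sub : (lker (linfun cL) <= lker h)%VS.
  apply/subvP=> v; rewrite !memv_ker lfunE /= => /eqP cv0.
  apply/eqP/form_nondeg => u; rewrite form_sym -adj.
  have : g u \in limg g by rewrite memv_img ?memvf.
  move/coord_vbasis ->.
  suff -> : b (\sum_(i < m) coord e i (g u) *: e`_i) v
            = \sum_(i < m) coord e i (g u) * b (e`_i) v.
    apply: big1 => i _; have /rowP/(_ i) := cv0.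
    by rewrite !mxE (tnth_nth 0) form_sym => ->; rewrite mulr0.
  have b0 : b 0 v = 0.
    by have := form_linear (-1) 0 0 v; rewrite scaler0 addr0 mulN1r addNr.
  apply: (big_ind2 (fun x y => b x v = y)) => // [x1 y1 x2 y2 <- <-|i _].
    by rewrite -[x1]scale1r form_linear mul1r scale1r.
  by rewrite -[_ *: _]addr0 form_linear b0 addr0.
have := dimvS sub.
have := limg_ker_dim h fullv; have := limg_ker_dim (linfun cL) fullv.
rewrite !capfv => Ec Eh le1.
have le2 : (\dim (limg (linfun cL)) <= m)%N.
  by apply: leq_trans (dimvS (subvf _)) _; rewrite dimvf /dim /= mul1n.
by rewrite -(leq_add2l (\dim (lker h))) Eh -Ec leq_add.
Qed.

(** The image of [f] is the direct sum of those of [f \o p] and [f \o q], and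
isotropy makes these two operators adjoint to each other, so they have the same
rank. *)
Lemma even_rank_selfadjoint (f p q : 'End(W)) :
  (forall u v, b (f u) v = b u (f v)) ->
  (forall u, p u + q u = u) ->
  (forall u v, b (f (p u)) (p v) = 0) ->
  (forall u v, b (f (q u)) (q v) = 0) ->
  ~~ odd (\dim (limg f)).
Proof.
move=> f_adj pq fp fq.
have formD u v w : b u (v + w) = b u v + b u w.
  by rewrite form_sym -[v]scale1r form_linear mul1r scale1r !(form_sym _ u).
have adj u v : b ((f \o p)%VF u) v = b u ((f \o q)%VF v).
  rewrite !comp_lfunE -[v in LHS]pq formD fp add0r f_adj.
  by rewrite form_sym -[u in RHS]pq [RHS]form_sym formD fq addr0.
have adj' u v : b ((f \o q)%VF u) v = b u ((f \o p)%VF v).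
  by rewrite form_sym -adj form_sym.
have eq_dim : \dim (limg (f \o p)%VF) = \dim (limg (f \o q)%VF).
  by apply/eqP; rewrite eqn_leq !dim_limg_adjoint_le.
have cap0 : (limg (f \o p)%VF :&: limg (f \o q)%VF = 0)%VS.
  apply/eqP; rewrite -subv0; apply/subvP=> w; rewrite memv_cap memv0.
  case/andP=> /memv_imgP[u _ wu] /memv_imgP[v _ wv].
  apply/eqP/form_nondeg=> z; rewrite -[z]pq formD.
  by rewrite {1}wu wv !comp_lfunE fp fq addr0.
have -> : limg f = (limg (f \o p)%VF + limg (f \o q)%VF)%VS.
  apply/eqP; rewrite eqEsubv; apply/andP; split.
    apply/subvP=> _ /memv_imgP[u _ ->]; rewrite -[u]pq linearD.
    by rewrite memv_add // limg_comp !memv_img ?memvf.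
  by rewrite subv_add !limg_comp !limgS ?subvf.
by rewrite dimv_disjoint_sum // eq_dim addnn odd_double.
Qed.

End Form.

(** * The curl of three matrices acting on a graded space *)

Section Curl.
Variables (K : fieldType) (d : nat).
Local Notation W := {ffun 'I_3 -> 'M[K]_d}.
Implicit Types (A B : 'M[K]_d) (u v w : W).

Definition trace_form u v : K := \sum_i \tr (u i *m v i).

Lemma trace_form_linear a u u' v :
  trace_form (a *: u + u') v = a * trace_form u v + trace_form u' v.
Proof.
rewrite /trace_form mulr_sumr -big_split; apply: eq_bigr => i _ /=.
by rewrite !ffunE mulmxDl linearD /= -scalemxAl linearZ.
Qed.

Lemma trace_form_sym u v : trace_form u v = trace_form v u.
Proof. by apply: eq_bigr => i _; rewrite mxtrace_mulC. Qed.

Lemma trace_form_nondeg u : (forall v, trace_form u v = 0) -> u = 0.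
Proof.
move=> u0; apply/ffunP=> i; apply/matrixP=> r c; rewrite ffunE mxE.
have := u0 [ffun j => if j == i then delta_mx c r else 0].
rewrite /trace_form (bigD1 i) //= big1 => [|j /negPf ne_ji]; last first.
  by rewrite ffunE ne_ji mulmx0 mxtrace0.
rewrite addr0 ffunE eqxx /mxtrace (bigD1 r) //= big1 => [|s /negPf ne_sr].
  rewrite addr0 mxE (bigD1 c) //= big1 => [|t /negPf ne_tc].
    by rewrite addr0 mxE !eqxx mulr1.
  by rewrite mxE ne_tc mulr0.
by rewrite mxE big1 // => t _; rewrite mxE ne_sr andbF mulr0.
Qed.

Variable X : 'I_3 -> 'M[K]_d.

Definition bracket A B := A *m B - B *m A.

(** The cross product of [X] and [u]: indices are added modulo 3, so that
[i + 1] and [i - 1] are the two indices following [i] cyclically. *)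
Definition curl_fun u : W :=
  [ffun i => bracket (X (i + 1)) (u (i - 1)) - bracket (X (i - 1)) (u (i + 1))].

Lemma bracket_linear A : linear (bracket A).
Proof.
move=> a B C; rewrite /bracket mulmxDr mulmxDl -scalemxAr -scalemxAl.
by rewrite scalerBr opprD addrACA.
Qed.

Lemma curl_linear : linear curl_fun.
Proof.
move=> a u v; apply/ffunP=> i; rewrite !ffunE !bracket_linear.
by rewrite opprD addrACA -scalerBr.
Qed.
HB.instance Definition _ := GRing.isLinear.Build K W W _ curl_fun curl_linear.

Definition curl : 'End(W) := linfun curl_fun.

(** Invariance of the trace form under the adjoint action. *)
Lemma mxtrace_bracket A B C : \tr (bracket A B *m C) = - \tr (B *m bracket A C).
Proof.
rewrite /bracket mulmxBl mulmxBr !linearB /= opprB !mulmxA.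
by rewrite -(mulmxA A) mxtrace_mulC.
Qed.

Lemma curl_selfadjoint u v : trace_form (curl u) v = trace_form u (curl v).
Proof.
rewrite /trace_form.
under eq_bigr do
  rewrite lfunE /= ffunE mulmxBl linearB /= !mxtrace_bracket opprK.
under [RHS]eq_bigr do rewrite lfunE /= ffunE mulmxBr linearB /=.
rewrite !big_split /= addrC; congr (_ + _).
  rewrite (reindex_inj (addIr (-1 : 'I_3))); apply: eq_bigr => i _ /=.
  congr (\tr (u _ *m bracket (X _) (v _))); apply/val_inj;
    by case: i => [[|[|[|]]] ?].
rewrite (reindex_inj (addIr (1 : 'I_3))); apply: eq_bigr => i _ /=.
congr (- \tr (u _ *m bracket (X _) (v _))); apply/val_inj;
  by case: i => [[|[|[|]]] ?].
Qed.

(** For three indices, the pairs [i, i + 1] exhaust the unordered pairs of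
distinct indices. *)
Lemma curl_kerP u : reflect
  (forall i j, bracket (X i) (u j) = bracket (X j) (u i)) (u \in lker curl).
Proof.
rewrite memv_ker lfunE /=; apply: (iffP eqP) => [cu0|sym]; last first.
  by apply/ffunP=> i; rewrite !ffunE sym subrr.
have next i : bracket (X (i + 1)) (u (i - 1)) = bracket (X (i - 1)) (u (i + 1)).
  by apply/eqP; rewrite -subr_eq0; move/ffunP/(_ i): cu0; rewrite !ffunE => ->.
suff step i : bracket (X i) (u (i + 1)) = bracket (X (i + 1)) (u i).
  move=> i j; have : [|| j == i, j == i + 1 | i == j + 1].
    case: i => [[|[|[|i]]] ?] //; case: j => [[|[|[|j]]] ?] //.
  by case/or3P=> /eqP->.
have -> : i + 1 = i - 1 - 1 by apply/val_inj; case: i => [[|[|[|i]]] ?].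
by have := next (i - 1); rewrite subrK.
Qed.

(* The projections [E e] onto the degree [e] part of [K^d] encode a grading for
   which the operators [X i], acting on row vectors, have degree one. *)
Variables (N : nat) (E : nat -> 'M[K]_d).
Hypothesis E_orth : forall e f, E e *m E f = if e == f then E e else 0.
Hypothesis E_sum : \sum_(e < N) E e = 1%:M.
Hypothesis X_degree : forall i e, E e *m X i = X i *m E e.+1.

(** The part of [A] mapping degree [e] to degree [f] with [R e f]: for [leq] the
part of nonnegative degree, for [gtn] the part of negative degree. *)
Definition blocks (R : rel nat) A :=
  \sum_(e < N) \sum_(f < N | R e f) E e *m A *m E f.

Lemma blocks_linear R : linear (blocks R).
Proof.
move=> a A B; rewrite /blocks scaler_sumr -big_split; apply: eq_bigr => e _ /=.
rewrite scaler_sumr -big_split; apply: eq_bigr => f _ /=.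
by rewrite mulmxDr mulmxDl -scalemxAr -scalemxAl.
Qed.

Lemma blocks_split A : blocks leq A + blocks gtn A = A.
Proof.
rewrite /blocks -big_split /=.
rewrite -[RHS]mulmx1 -[in RHS](mul1mx A) -E_sum mulmx_suml mulmx_suml.
apply: eq_bigr => e _ /=.
rewrite mulmx_sumr [RHS](bigID (fun f : 'I_N => e <= f)%N) /=.
by congr (_ + _); apply: eq_bigl => f /=; rewrite ltnNge.
Qed.

(** If [A] goes from degree [e] to degree [f] then [X i] goes on to degree
[f.+1], and for a nonzero trace [B] has to come back from there to [e]. *)
Lemma blocks_isotropic (R : rel nat) i A B :
  (forall e f, R e f -> ~~ R f.+1 e) ->
  \tr (blocks R A *m X i *m blocks R B) = 0.
Proof.
move=> notR; rewrite /blocks mulmx_suml mulmx_suml raddf_sum /= big1 // => e _.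
rewrite mulmx_suml mulmx_suml raddf_sum /= big1 // => f Ref.
rewrite mulmx_sumr raddf_sum /= big1 // => g _.
rewrite mulmx_sumr raddf_sum /= big1 // => h Rgh.
rewrite -(mulmxA _ (E f)) X_degree !mulmxA -(mulmxA _ (E f.+1)) E_orth.
case: eqP => [fg|_]; last by rewrite mulmx0 !mul0mx mxtrace0.
rewrite mxtrace_mulC !mulmxA E_orth.
case: eqP => [he|_]; last by rewrite !mul0mx mxtrace0.
by have := notR _ _ Ref; rewrite fg -he Rgh.
Qed.

Definition blockwise R u : W := [ffun i => blocks R (u i)].

Lemma blockwise_linear R : linear (blockwise R).
Proof. by move=> a u v; apply/ffunP=> i; rewrite !ffunE blocks_linear. Qed.
HB.instance Definition _ R :=
  GRing.isLinear.Build K W W _ (blockwise R) (blockwise_linear R).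

Lemma curl_isotropic (R : rel nat) u v :
  (forall e f, R e f -> ~~ R f.+1 e) ->
  trace_form (curl (blockwise R u)) (blockwise R v) = 0.
Proof.
move=> notR; apply: big1 => i _; rewrite lfunE /= !ffunE /bracket.
have tr1 j A B : \tr (X j *m blocks R A *m blocks R B) = 0.
  by rewrite mxtrace_mulC mulmxA blocks_isotropic.
rewrite !mulmxBl !linearB /= !tr1.
by rewrite !blocks_isotropic // !subrr.
Qed.

Lemma even_rank_curl : ~~ odd (\dim (limg curl)).
Proof.
apply: (even_rank_selfadjoint trace_form_linear trace_form_sym trace_form_nondeg
  (p := linfun (blockwise leq)) (q := linfun (blockwise gtn))).
- exact: curl_selfadjoint.
- by move=> u; rewrite !lfunE; apply/ffunP=> i; rewrite !ffunE blocks_split.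
- move=> u v; rewrite !(lfunE (blockwise leq)).
  by apply: curl_isotropic => e f; rewrite -ltnNge.
- move=> u v; rewrite !(lfunE (blockwise gtn)).
  by apply: curl_isotropic => e f /= fe; rewrite -leqNgt.
Qed.

End Curl.

(** * Polynomials evaluated at commuting matrices *)

Lemma mpoly_mulX_ind n (R : comNzRingType) (P : {mpoly R[n]} -> Prop) :
  (forall c p q, P p -> P q -> P (c *: p + q)) ->
  P 1 -> (forall i p, P p -> P ('X_i * p)) -> forall p, P p.
Proof.
move=> Plin P1 PX.
have P0 : P 0 by rewrite -(addNr 1) -scaleN1r; apply: Plin.
elim/mpolyind=> // c m p _ _ Pp; apply: Plin => //.
rewrite mpolyXE_id -[\prod_(i < n) _]mulr1.
apply: (big_ind (fun q => forall r, P r -> P (q * r))) => //.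
- by move=> r; rewrite mul1r.
- by move=> q1 q2 Pq1 Pq2 r Pr; rewrite -mulrA; auto.
- move=> i _; elim: (m i) => [|e IHe] r Pr; first by rewrite expr0 mul1r.
  by rewrite exprS -mulrA; auto.
Qed.

(** Evaluation at the [Y i], which commute with each other but in general not
with all matrices. *)
Lemma commuting_eval n (k : fieldType) N (Y : 'I_n -> 'M[k]_N) :
  (forall i j, Y i *m Y j = Y j *m Y i) ->
  exists rho : {linear {mpoly k[n]} -> 'M[k]_N},
    rho 1 = 1%:M /\ forall i p, rho ('X_i * p) = Y i *m rho p.
Proof.
case: N Y => [|N] Y cY.
  exists (\0 : {linear {mpoly k[n]} -> 'M[k]_0}).
  by split=> [|i p]; rewrite [LHS]flatmx0 [RHS]flatmx0.
pose f : {rmorphism k -> 'M[k]_N.+1} := @scalar_mx k N.+1.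
have flin : linear (mmap f Y).
  by move=> c p q; rewrite mmapD mmapZ /= -mul_scalar_mx.
pose rM := GRing.isLinear.Build k {mpoly k[n]} 'M[k]_N.+1 _ (mmap f Y) flin.
pose rho : {linear {mpoly k[n]} -> 'M[k]_N.+1} := HB.pack (mmap f Y) rM.
have rhoX m : rho 'X_[m] = mmap1 Y m by exact: mmapX.
exists rho; split=> [|i p]; first by rewrite -mpolyX0 rhoX mmap11.
elim/mpolyind: p => [|c m p _ _ IHp]; first by rewrite mulr0 linear0 mulmx0.
rewrite mulrDr -scalerAr !(linearP rho) IHp mulmxDr -scalemxAr.
congr (_ *: _ + _).
rewrite -mpolyXD !rhoX -[in RHS](mmap1U Y i).
have <- : mmap1 Y U_(i) * mmap1 Y m = mmap1 Y U_(i) *m mmap1 Y m by [].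
rewrite /mmap1 -prodrM_comm => [|j l _ _].
  by apply: eq_bigr => j _; rewrite mnmDE exprD.
by apply/commrX/commr_sym/commrX/cY.
Qed.

Lemma pihomog_mulX n (k : fieldType) (i : 'I_n) e (p : {mpoly k[n]}) :
  pihomog (@mdeg n) e.+1 ('X_i * p) = 'X_i * pihomog (@mdeg n) e p.
Proof.
elim/mpolyind: p => [|c m p _ _ IHp]; first by rewrite mulr0 !linear0 mulr0.
rewrite mulrDr -scalerAr !linearP /= IHp mulrDr -scalerAr -mpolyXD.
by rewrite !pihomogX /= mdegD mdeg1 add1n eqSS;
  case: eqP; rewrite ?mpolyXD ?mulr0.
Qed.

(** * The tangent space as cocycles modulo coboundaries *)

Lemma eq_mulmx_rV (K : fieldType) m n (A B : 'M[K]_(m, n)) :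
  (forall v : 'rV[K]_m, v *m A = v *m B) -> A = B.
Proof. by move=> AB; apply/row_matrixP=> i; rewrite !rowE. Qed.

Lemma has_dim_image (k : fieldType) (T : lmodType k) (W : vectType k)
    (V : {vspace W}) (h : {linear T -> W}) :
  (forall t, h t \in V) -> (forall w, w \in V -> exists t, h t = w) ->
  (forall t, h t = 0 -> t = 0) -> has_dim T (\dim V).
Proof.
move=> hV hsurj hinj; pose e := vbasis V.
pose c t : 'rV[k]_(\dim V) := \row_i coord e i (h t).
have c_lin : linear c.
  by move=> a s t; apply/rowP=> i; rewrite !mxE !linearP.
have eV (r : 'rV[k]_(\dim V)) : exists t, h t = \sum_i r 0 i *: e`_i.
  apply: hsurj; apply: rpred_sum => i _; apply: rpredZ.
  by rewrite vbasis_mem // mem_nth // size_tuple.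
have [c' c'E] := choice eV.
split; exists c => //; exists c' => [t|r].
  apply/eqP; rewrite -subr_eq0; apply/eqP/hinj.
  rewrite linearB c'E [X in _ - X](coord_vbasis (hV t)); apply/eqP.
  by rewrite subr_eq0; apply/eqP/eq_bigr => i _; rewrite mxE.
by apply/rowP=> i; rewrite mxE c'E coord_sum_free ?(basis_free (vbasisP V)).
Qed.

Section TangentSpace.
Variables (n : nat) (k : fieldType) (I : idealr {mpoly k[n]}) (d : nat).
Local Notation S := {mpoly k[n]}.
Local Notation M := (restr_mod (quot_mod I)).
Variables (iota : {linear M -> 'rV[k]_d}) (kappa : {linear 'rV[k]_d -> M}).
Hypotheses (iotaK : cancel iota kappa) (kappaK : cancel kappa iota).
Implicit Types (p q : S) (v : 'rV[k]_d).

(** The class of [p] modulo the ideal, in the coordinates [iota]; [rep] is a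
linear section of it. *)
Definition residue p : 'rV[k]_d := iota (\pi_{ideal_quot I} p : {ideal_quot I}).

Lemma residue_linear : linear residue.
Proof.
move=> c p q; rewrite /residue -linearP; congr (iota _).
by rewrite [LHS]rmorphD -mul_mpolyC [X in X + _]rmorphM.
Qed.
HB.instance Definition _ :=
  GRing.isLinear.Build k S 'rV[k]_d _ residue residue_linear.

Lemma residue_eq0 p : (residue p == 0) = (p \in (I : pred _)).
Proof.
rewrite -[X in _ = (X \in _)]subr0 Quotient.idealrBE -(inj_eq (can_inj iotaK)).
by congr (_ == _); rewrite -[LHS](linear0 residue).
Qed.

Lemma eq_residue p q : (p - q \in (I : pred _)) = (residue p == residue q).
Proof. by rewrite -residue_eq0 linearB subr_eq0. Qed.

Definition rep v : S :=
  \sum_j v 0 j *: repr (kappa (delta_mx 0 j) : {ideal_quot I}).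

Lemma rep_linear : linear rep.
Proof.
move=> c u v; rewrite /rep scaler_sumr -big_split; apply: eq_bigr => j _ /=.
by rewrite !mxE scalerDl scalerA.
Qed.
HB.instance Definition _ := GRing.isLinear.Build k 'rV[k]_d S _ rep rep_linear.

Lemma repK : cancel rep residue.
Proof.
move=> v; rewrite /rep linear_sum [RHS]row_sum_delta; apply: eq_bigr => j _.
by rewrite linearZ /= /residue reprK kappaK.
Qed.

Definition act_fun p v := residue (p * rep v).

Lemma act_fun_linear p : linear (act_fun p).
Proof. by move=> c u v; rewrite /act_fun linearP mulrDr -scalerAr linearP. Qed.
HB.instance Definition _ p :=
  GRing.isLinear.Build k 'rV[k]_d 'rV[k]_d _ (act_fun p) (act_fun_linear p).

(** Multiplication by [p] on the quotient. Matrices act on row vectors from the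
right, so [act (p * q)] multiplies by [q] first. *)
Definition act p : 'M[k]_d := lin1_mx (act_fun p).

Lemma mul_act v p : v *m act p = residue (p * rep v).
Proof. by rewrite mul_rV_lin1. Qed.

Lemma residueM p q : residue (p * q) = residue q *m act p.
Proof.
apply/eqP; rewrite mul_act -eq_residue -mulrBr idealMr //.
by rewrite eq_residue repK.
Qed.

Lemma act_linear : linear act.
Proof.
move=> c p q; apply: eq_mulmx_rV => v.
by rewrite mulmxDr -scalemxAr !mul_act mulrDl -scalerAl linearP.
Qed.
HB.instance Definition _ := GRing.isLinear.Build k S 'M[k]_d _ act act_linear.

Lemma act1 : act 1 = 1%:M.
Proof. by apply: eq_mulmx_rV => v; rewrite mul_act mul1r repK mulmx1. Qed.

Lemma actM p q : act (p * q) = act q *m act p.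
Proof.
by apply: eq_mulmx_rV => v; rewrite mul_act -mulrA residueM -mul_act mulmxA.
Qed.

Lemma actC p q : act p *m act q = act q *m act p.
Proof. by rewrite -!actM mulrC. Qed.

Lemma act_ideal p : p \in (I : pred _) -> act p = 0.
Proof.
move=> Ip; apply: eq_mulmx_rV => v; rewrite mul_act mulmx0.
by apply/eqP; rewrite residue_eq0 mulrC idealMr.
Qed.

Lemma residue1_act p : residue 1 *m act p = residue p.
Proof. by rewrite -residueM mulr1. Qed.

Lemma act_rep_residue p : act (rep (residue p)) = act p.
Proof.
apply/eqP; rewrite -subr_eq0 -linearB /= act_ideal //.
by rewrite eq_residue repK.
Qed.

Lemma iotaZ p (x : quot_mod I) : iota (p *: x) = iota x *m act p.
Proof.
rewrite -[x](reprK (x : {ideal_quot I})) -residueM; congr (iota _).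
by rewrite [RHS]rmorphM.
Qed.

Fact defect_subproof p v : p * rep v - rep (v *m act p) \in (I : pred _).
Proof. by rewrite eq_residue repK mul_act. Qed.

(** A linear section of the projection onto the quotient is not a module
morphism; [defect p v] measures this failure inside the ideal. *)
Definition defect p v : ideal_mod I := IdealMod (defect_subproof p v).

(** The derivation with values in the endomorphisms of the quotient attached to
[phi]; it represents the extension of the quotient by itself obtained by pushing
out along [phi]. *)
Definition defect_mx (phi : hom_mod (ideal_mod I) (quot_mod I)) p :=
  lin1_mx (fun v => iota (phi (defect p v))).

Lemma mul_defect_mx phi p v : v *m defect_mx phi p = iota (phi (defect p v)).
Proof.
pose f v := iota (phi (defect p v)).
have flin : linear f.
  move=> c x y; rewrite /f -linearP; congr (iota _).
  rewrite -[c *: (phi (defect p x) : M)]/(c%:MP_[n] *: phi (defect p x)).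
  rewrite -linearP.
  congr (phi _); apply: val_inj; rewrite /= mulmxDl -scalemxAl !linearP /=.
  rewrite mul_mpolyC. by rewrite mulrDr -scalerAr addrACA -scalerDr.
pose fM := GRing.isLinear.Build k 'rV[k]_d 'rV[k]_d _ f flin.
pose fL : {linear 'rV[k]_d -> 'rV[k]_d} := HB.pack f fM.
exact: (mul_rV_lin1 fL).
Qed.

Lemma defect_mx_linear phi : linear (defect_mx phi).
Proof.
move=> c p q; apply: eq_mulmx_rV => v.
rewrite mulmxDr -scalemxAr !mul_defect_mx -linearP; congr (iota _).
rewrite -[c *: (phi (defect p v) : M)]/(c%:MP_[n] *: phi (defect p v)) -linearP.
congr (phi _); apply: val_inj.
rewrite /= linearP /= mulmxDr -scalemxAr linearP /=.
by rewrite mul_mpolyC mulrDl -scalerAl scalerBr opprD addrACA.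
Qed.

(** The Leibniz rule: multiply by [q] first and by [p] next, and add up the two
defects. *)
Lemma defect_mxM phi p q :
  defect_mx phi (p * q) = defect_mx phi q *m act p + act q *m defect_mx phi p.
Proof.
apply: eq_mulmx_rV => v; rewrite mulmxDr !mulmxA !mul_defect_mx -iotaZ.
rewrite -[RHS]linearD; congr (iota _).
rewrite -[X in X + _]linearZ -linearD; congr (phi _); apply: val_inj => /=.
by rewrite mulrBr mulrA addrA subrK -mulmxA -actM.
Qed.

Lemma defect_mx1 phi : defect_mx phi 1 = 0.
Proof.
apply: eq_mulmx_rV => v; rewrite mul_defect_mx mulmx0 -[RHS](linear0 iota).
congr (iota _); rewrite -[RHS](linear0 phi).
congr (phi _); apply: val_inj => /=.
by rewrite mul1r act1 mulmx1 subrr.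
Qed.

Local Notation X := (fun i : 'I_n => act 'X_i).
Local Notation W := {ffun 'I_n -> 'M[k]_d}.

Definition cocycle (u : W) :=
  forall i j, bracket (X i) (u j) = bracket (X j) (u i).

Definition coboundary_fun A : W := [ffun i => bracket A (X i)].

Lemma coboundary_linear : linear coboundary_fun.
Proof.
move=> c A B; apply/ffunP=> i; rewrite !ffunE /bracket mulmxDl mulmxDr.
by rewrite -scalemxAl -scalemxAr scalerBr opprD addrACA.
Qed.
HB.instance Definition _ :=
  GRing.isLinear.Build k 'M[k]_d W _ coboundary_fun coboundary_linear.

Definition coboundary : 'Hom('M[k]_d, W) := linfun coboundary_fun.

Lemma coboundaryE A i : coboundary A i = A *m X i - X i *m A.
Proof. by rewrite lfunE /= ffunE. Qed.

Lemma coboundary_cocycle A : cocycle (coboundary A).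
Proof.
move=> i j; rewrite !coboundaryE /bracket !mulmxBl !mulmxBr !mulmxA.
rewrite (actC 'X_i 'X_j) -!(mulmxA A) (actC 'X_i 'X_j).
by rewrite !opprB addrACA [RHS]addrACA [X in _ = X + _]addrC.
Qed.

Definition tangent_cocycle (phi : hilb_tangent I) : W :=
  [ffun i => defect_mx phi 'X_i].

Lemma tangent_cocycle_linear : linear tangent_cocycle.
Proof.
move=> c phi psi; apply/ffunP=> i; rewrite !ffunE; apply: eq_mulmx_rV => v.
by rewrite mulmxDr -scalemxAr !mul_defect_mx -linearP.
Qed.
HB.instance Definition _ :=
  GRing.isLinear.Build k (hilb_tangent I) W _
    tangent_cocycle tangent_cocycle_linear.

(** The Leibniz rule, applied to the two products of the same variables. *)
Lemma tangent_cocycleP phi : cocycle (tangent_cocycle phi).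
Proof.
move=> i j; rewrite !ffunE /bracket.
have := congr1 (defect_mx phi) (mulrC 'X_i 'X_j : _ = _ :> S).
rewrite !defect_mxM => defectC; apply/eqP.
by rewrite subr_eq addrAC eq_sym subr_eq addrC defectC addrC.
Qed.

(** Two derivations that agree on the variables are equal, so the one attached
to [phi] is inner; an inner derivation maps an element of the ideal to zero,
while the value of this one at [residue 1] is that of [phi]. *)
Lemma tangent_cocycle_eq_coboundary phi A :
  tangent_cocycle phi = coboundary A -> phi = 0.
Proof.
move=> phiA.
have defectE p : defect_mx phi p = A *m act p - act p *m A.
  elim/mpoly_mulX_ind: p => [c p q IHp IHq||i p IHp].
  - rewrite defect_mx_linear act_linear IHp IHq.
    rewrite mulmxDr mulmxDl -scalemxAr -scalemxAl scalerBr.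
    by rewrite opprD addrACA.
  - by rewrite defect_mx1 act1 mulmx1 mul1mx subrr.
  - have /ffunP/(_ i) := phiA; rewrite coboundaryE ffunE => phiX.
    rewrite defect_mxM phiX IHp actM mulmxBl mulmxBr !mulmxA.
    by rewrite subrKA.
apply: hom_modP => u; apply: (can_inj iotaK); rewrite [RHS](linear0 iota).
have Iu := valP u.
have := congr1 (mulmx (residue 1)) (defectE (val u)).
rewrite mul_defect_mx act_ideal // mulmx0 mul0mx subrr mulmx0 => <-.
have -> : defect (val u) (residue 1) = rep (residue 1) *: u.
  apply: val_inj; rewrite /= act_ideal // mulmx0 linear0 subr0.
  exact: mulrC.
by rewrite linearZ iotaZ act_rep_residue act1 mulmx1.
Qed.

(** The cocycle condition says that the block matrices [Y i], which define the
extension of the quotient by itself given by [u], commute. Evaluating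
polynomials at them yields a derivation [D] with [D 'X_i = u i], and
[phi p = D p (residue 1)] is linear over polynomials on the ideal because the
ideal acts by zero. *)
Lemma cocycle_tangent (u : W) : cocycle u ->
  exists (phi : hilb_tangent I) A, tangent_cocycle phi = u + coboundary A.
Proof.
move=> cu.
pose Y i : 'M[k]_(d + d) := block_mx (X i) (u i) 0 (X i).
have cY i j : Y i *m Y j = Y j *m Y i.
  rewrite /Y !mulmx_block !mul0mx !mulmx0 !addr0 !add0r (actC 'X_i 'X_j).
  congr (block_mx _ _ _ _); apply/eqP; have /eqP := cu i j; rewrite /bracket.
  by rewrite subr_eq addrAC eq_sym subr_eq addrC eq_sym [in X in _ == X]addrC.
have [rho [rho1 rhoX]] := commuting_eval cY.
pose D p := ursubmx (rho p).
have rhoE p : rho p = block_mx (act p) (D p) 0 (act p).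
  suff [pu pl pr] : [/\ ulsubmx (rho p) = act p, dlsubmx (rho p) = 0
      & drsubmx (rho p) = act p] by rewrite -[LHS]submxK pu pl pr.
  elim/mpoly_mulX_ind: p => [c p q [pu pl pr] [qu ql qr]||i p [pu pl pr]].
  - rewrite (linearP rho) (linearP act) -[rho p]submxK -[rho q]submxK.
    rewrite pu pl pr qu ql qr scale_block_mx add_block_mx.
    by rewrite block_mxKul block_mxKdl block_mxKdr scaler0 addr0.
  - by rewrite rho1 act1 scalar_mx_block block_mxKul block_mxKdl block_mxKdr.
  - rewrite rhoX -[rho p]submxK pu pl pr mulmx_block !mul0mx !mulmx0.
    by rewrite block_mxKul block_mxKdl block_mxKdr !addr0 add0r actM actC.
have D_lin : linear D.
  by move=> c p q; rewrite /D linearP; apply/matrixP=> i j; rewrite !mxE.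
have DX i p : D ('X_i * p) = act 'X_i *m D p + u i *m act p.
  by rewrite /D rhoX [rho p]rhoE mulmx_block !block_mxKur.
have D1 : D 1 = 0.
  by rewrite /D rho1 scalar_mx_block block_mxKur.
have DM p q : D (p * q) = act p *m D q + D p *m act q.
  elim/mpoly_mulX_ind: p => [c p1 p2 IH1 IH2||i p IHp].
  - rewrite mulrDl -scalerAl !D_lin IH1 IH2 act_linear !mulmxDl -!scalemxAl.
    by rewrite scalerDr addrACA.
  - by rewrite mul1r act1 mul1mx D1 mul0mx addr0.
  - rewrite -mulrA !DX IHp !actM (actC q p) (actC p 'X_i) mulmxDr mulmxDl.
    by rewrite !mulmxA !addrA.
have DI p q : q \in (I : pred _) -> D (p * q) = D q *m act p.
  by move=> Iq; rewrite mulrC DM act_ideal // mul0mx add0r.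
pose f (x : ideal_mod I) : quot_mod I := kappa (residue 1 *m D (val x)).
have flin : linear f.
  move=> p x y; apply: (can_inj iotaK).
  rewrite [RHS]linearD iotaZ /f !kappaK -mulmxA -DI ?(valP x) // -mulmxDr.
  by congr (_ *m _); rewrite -[in RHS](scale1r (D _)) -D_lin scale1r.
pose fM := GRing.isLinear.Build S (ideal_mod I) (quot_mod I) _ f flin.
pose phi : {linear ideal_mod I -> quot_mod I} := HB.pack f fM.
(* The derivation of [phi] differs from [D] by the inner one given by [A]. *)
pose g v := residue 1 *m D (rep v).
have glin : linear g.
  by move=> c x y; rewrite /g linearP D_lin mulmxDr -scalemxAr.
pose gM := GRing.isLinear.Build k 'rV[k]_d 'rV[k]_d _ g glin.
pose A := lin1_mx (HB.pack g gM : {linear 'rV[k]_d -> 'rV[k]_d}).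
have mulA v : v *m A = residue 1 *m D (rep v) by rewrite mul_rV_lin1.
exists phi, A; apply/ffunP=> i; rewrite !ffunE coboundaryE.
apply: eq_mulmx_rV => v; rewrite mul_defect_mx /= /f kappaK /=.
rewrite -scaleN1r addrC D_lin scaleN1r mulmxDr mulmxN -mulA.
rewrite mulrC DM !mulmxDr !mulmxA -mulA residue1_act repK.
have -> : D 'X_i = u i.
  by rewrite -[LHS]/(D _) -['X_i]mulr1 DX D1 mulmx0 add0r act1 mulmx1.
by rewrite mulmxN mulmxA [LHS]addrC -addrA.
Qed.

(** A matrix commuting with the action is determined by its value at
[residue 1], which is arbitrary: the kernel of [coboundary] is isomorphic to
the quotient. *)
Lemma dim_limg_coboundary : (\dim (limg coboundary) + d = d * d)%N.
Proof.
pose ev : 'Hom('M[k]_d, 'rV[k]_d) := linfun (mulmx (residue 1)).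
have commE A : A \in lker coboundary -> forall p, A *m act p = act p *m A.
  rewrite memv_ker => /eqP/ffunP A0.
  elim/mpoly_mulX_ind=> [c p q IHp IHq||i p IHp].
  - rewrite (linearP act) mulmxDr mulmxDl -scalemxAr -scalemxAl.
    by rewrite IHp IHq.
  - by rewrite act1 mulmx1 mul1mx.
  - have := A0 i; rewrite coboundaryE ffunE => /subr0_eq AX.
    by rewrite actM mulmxA IHp -!mulmxA AX.
have inj : (lker coboundary :&: lker ev = 0)%VS.
  apply/eqP; rewrite -subv0; apply/subvP=> A; rewrite memv_cap memv0.
  case/andP=> /commE cA; rewrite memv_ker lfunE /= => /eqP evA.
  apply/eqP/eq_mulmx_rV => v; rewrite mulmx0 -[v]repK -residue1_act.
  by rewrite -mulmxA -cA mulmxA evA mul0mx.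
have surj : (ev @: lker coboundary = fullv)%VS.
  apply/eqP; rewrite eqEsubv subvf /=; apply/subvP=> v _.
  have -> : v = ev (act (rep v)) by rewrite lfunE /= residue1_act repK.
  apply: memv_img; rewrite memv_ker; apply/eqP/ffunP=> i.
  by rewrite coboundaryE ffunE actC subrr.
have := limg_ker_dim coboundary fullv; rewrite capfv.
have := limg_dim_eq inj; rewrite surj !dimvf => <-.
by rewrite /dim /= mul1n addnC.
Qed.

Lemma has_dim_tangent (Z : {vspace W}) :
  (forall u, reflect (cocycle u) (u \in Z)) ->
  exists2 t, has_dim (hilb_tangent I) t &
    (t + \dim (limg coboundary) = \dim Z)%N.
Proof.
move=> ZP; set U := limg coboundary.
have UZ : (U <= Z)%VS.
  by apply/subvP=> _ /memv_imgP[A _ ->]; apply/ZP/coboundary_cocycle.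
(* A linear map with kernel [U], used in place of the quotient by [U]. *)
pose g : 'End(W) := (\1 - projv U)%VF.
have kerg : lker g = U.
  apply/vspaceP=> u; rewrite memv_ker add_lfunE opp_lfunE id_lfunE subr_eq0.
  apply/eqP/idP=> [->|Uu]; [exact: memv_proj | exact/esym/projv_id].
have glin : linear (fun phi : hilb_tangent I => g (tangent_cocycle phi)).
  by move=> c phi psi; rewrite !linearP.
pose gM := GRing.isLinear.Build k (hilb_tangent I) W _ _ glin.
pose gL : {linear hilb_tangent I -> W} :=
  HB.pack (fun phi : hilb_tangent I => g (tangent_cocycle phi)) gM.
exists (\dim (g @: Z)); last first.
  by rewrite -(limg_ker_dim g Z) kerg (capv_idPr UZ) addnC.
apply: (@has_dim_image _ _ _ _ gL) => [phi|w|phi] /=.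
- exact/memv_img/ZP/tangent_cocycleP.
- case/memv_imgP=> u /ZP/cocycle_tangent[phi [A phiE]] ->; exists phi.
  have : coboundary A \in lker g by rewrite kerg memv_img ?memvf.
  by rewrite memv_ker phiE linearD /= => /eqP->; rewrite addr0.
- move/eqP; rewrite -memv_ker kerg => /memv_imgP[A _].
  exact: tangent_cocycle_eq_coboundary.
Qed.

(** * The grading of the quotient by a homogeneous ideal *)

Hypothesis I_homog : homogeneous_ideal I.

Definition degree_fun e v := residue (pihomog (@mdeg n) e (rep v)).

Lemma degree_fun_linear e : linear (degree_fun e).
Proof. by move=> c u v; rewrite /degree_fun !linearP. Qed.
HB.instance Definition _ e :=
  GRing.isLinear.Build k 'rV[k]_d 'rV[k]_d _ (degree_fun e)
    (degree_fun_linear e).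

Definition degree_proj e : 'M[k]_d := lin1_mx (degree_fun e).

Lemma residue_degree_proj e p :
  residue p *m degree_proj e = residue (pihomog (@mdeg n) e p).
Proof.
rewrite mul_rV_lin1; apply/eqP; rewrite -eq_residue -linearB /= I_homog //.
by rewrite eq_residue repK.
Qed.

Lemma degree_proj_orth e f :
  degree_proj e *m degree_proj f = if e == f then degree_proj e else 0.
Proof.
apply: eq_mulmx_rV => v; rewrite -[v]repK mulmxA !residue_degree_proj.
case: eqP => [<-|/eqP ne_ef]; first by rewrite residue_degree_proj pihomog_id.
by rewrite (pihomog_ne0 ne_ef) ?pihomogP // linear0 mulmx0.
Qed.

Lemma degree_proj_act e i : degree_proj e *m X i = X i *m degree_proj e.+1.
Proof.
apply: eq_mulmx_rV => v; rewrite -[v]repK !mulmxA residue_degree_proj.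
by rewrite -!residueM residue_degree_proj pihomog_mulX.
Qed.

Lemma degree_proj_sum : exists N, \sum_(e < N) degree_proj e = 1%:M.
Proof.
pose N := \max_(j < d) msize (rep (delta_mx ord0 j)).
exists N; apply/row_matrixP=> j; rewrite !rowE mulmx1 mulmx_sumr.
rewrite -[in RHS](repK (delta_mx ord0 j)).
have le_N : (msize (rep (delta_mx ord0 j)) <= N)%N := leq_bigmax j.
rewrite [in RHS](pihomog_partitionE le_N).
rewrite linear_sum; apply: eq_bigr => e _ /=.
by rewrite -residue_degree_proj repK.
Qed.

End TangentSpace.

(** * The parity of the dimension of the tangent space *)

Theorem theorem1 (k : closedFieldType) (d : nat) (d_gt0 : (0 < d)%N)
    (I : idealr {mpoly k[3]})
    (I_homog : homogeneous_ideal I)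
    (dim_quot : has_dim (restr_mod (quot_mod I)) d) :
  exists t : nat, has_dim (hilb_tangent I) t /\ (t = d %[mod 2])%N.
Proof.
case: dim_quot => -[f f_lin [g gK fK]].
pose fM := GRing.isLinear.Build k (restr_mod (quot_mod I)) 'rV[k]_d _ f f_lin.
pose iota : {linear restr_mod (quot_mod I) -> 'rV[k]_d} := HB.pack f fM.
have g_lin : linear g by apply: (@can2_linear _ _ _ iota).
pose gM := GRing.isLinear.Build k 'rV[k]_d (restr_mod (quot_mod I)) _ g g_lin.
pose kappa : {linear 'rV[k]_d -> restr_mod (quot_mod I)} := HB.pack g gM.
have iotaK : cancel iota kappa by exact: gK.
have kappaK : cancel kappa iota by exact: fK.
pose X (i : 'I_3) := act iota kappa 'X_i.
have [N sumN] := degree_proj_sum iotaK kappaK I_homog.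
have even_curl := even_rank_curl (degree_proj_orth iotaK kappaK I_homog) sumN
  (fun i e => degree_proj_act iotaK kappaK I_homog e i).
have [t t_dim tE] :=
  has_dim_tangent iotaK kappaK (Z := lker (curl X)) (@curl_kerP _ _ X).
exists t; split=> //; rewrite !modn2; congr (nat_of_bool _).
have := limg_ker_dim (curl X) fullv; have := dim_limg_coboundary iotaK kappaK.
have dimW : \dim {: {ffun 'I_3 -> 'M[k]_d}} = (3 * (d * d))%N.
  by rewrite dimvf /dim /= card_ord.
(* With U the coboundaries: dim U + d = d^2 and t + dim U + rank = 3 d^2. *)
rewrite capfv dimW -tE => /(congr1 odd) + /(congr1 odd).
rewrite !oddD !oddM (negPf even_curl) addbF.
by case: odd; case: odd; case: odd.
Qed.
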